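(* Let $\mathsf W=(f_1,f_2,g_1,g_2,f_3,g_3)$ be a (mixed) wiring such that $f_1=f_2=f(x)$ and $g_1=g_2=g(y)$ for some functions $f,g:\{0,1\}\to[0,1]$ (i.e. $f_1,f_2$ depend only on $x$ and are equal, and $g_1,g_2$ depend only on $y$ and are equal). Let $\mathcal B_{\mathsf W}=(\mathcal B,\boxtimes_{\mathsf W})$ be the algebra of boxes induced by $\mathsf W$. Then: (i) $\mathcal B_{\mathsf W}$ is commutative if and only if $f_3$ and $g_3$ are symmetric in the last two variables, in the sense that $f_3(x,a_1,a_2)=f_3(x,a_2,a_1)$ for all $x,a_1,a_2\in\{0,1\}$ and $g_3(y,b_1,b_2)=g_3(y,b_2,b_1)$ for all $y,b_1,b_2\in\{0,1\}$. If in addition $f(x)=x$ and $g(y)=y$, then: (ii) $\mathcal B_{\mathsf W}$ is associative if and only if $f_3$ and $g_3$ are associative in the last two variables, in the sense that $f_3(x,a_1,f_3(x,a_2,a_3))=f_3(x,f_3(x,a_1,a_2),a_3)$ for all $x,a_1,a_2,a_3\in\{0,1\}$ and $g_3(y,b_1,g_3(y,b_2,b_3))=g_3(y,g_3(y,b_1,b_2),b_3)$ for all $y,b_1,b_2,b_3\in\{0,1\}$.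
   Context: Let $\mathcal B$ be the real vector space of all functions $\mathtt P:\{0,1\}^4\to\mathbb R$, written $\mathtt P(a,b\,|\,x,y)$. A mixed wiring $\mathsf W$ consists of six functions $f_1,f_2,g_1,g_2:\{0,1\}^2\to[0,1]$ and $f_3,g_3:\{0,1\}^3\to[0,1]$ such that for all $x\in\{0,1\}$: $(f_1(x,0)-f_1(x,1))(f_2(x,0)-f_2(x,1))=0$, and for all $y\in\{0,1\}$: $(g_1(y,0)-g_1(y,1))(g_2(y,0)-g_2(y,1))=0$. It is deterministic if all six functions take values in $\{0,1\}$. For $\alpha,\beta\in[0,1]$ write $\mathtt P(a,b\,|\,\alpha,\beta):=(1-\alpha)(1-\beta)\mathtt P(a,b\,|\,0,0)+(1-\alpha)\beta\,\mathtt P(a,b\,|\,0,1)+\alpha(1-\beta)\mathtt P(a,b\,|\,1,0)+\alpha\beta\,\mathtt P(a,b\,|\,1,1)$. The wiring induces a bilinear product on $\mathcal B$: $$\mathtt P\boxtimes_{\mathsf W}\mathtt Q(a,b\,|\,x,y)=\sum_{a_1,a_2,b_1,b_2\in\{0,1\}}\mathtt P\big(a_1,b_1\,|\,f_1(x,a_2),g_1(y,b_2)\big)\,\mathtt Q\big(a_2,b_2\,|\,f_2(x,a_1),g_2(y,b_1)\big)\,F(a\,|\,x,a_1,a_2)\,G(b\,|\,y,b_1,b_2),$$ where $F(1\,|\,x,a_1,a_2)=f_3(x,a_1,a_2)$, $F(0\,|\,x,a_1,a_2)=1-f_3(x,a_1,a_2)$, and likewise $G(1\,|\,y,b_1,b_2)=g_3(y,b_1,b_2)$,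 $G(0\,|\,y,b_1,b_2)=1-g_3(y,b_1,b_2)$. (For a deterministic wiring, $F$ and $G$ are the indicators $\mathbf 1_{a=f_3(x,a_1,a_2)}$ and $\mathbf 1_{b=g_3(y,b_1,b_2)}$.) The algebra $\mathcal B_{\mathsf W}$ is $\mathcal B$ equipped with $\boxtimes_{\mathsf W}$; commutativity and associativity refer to this product on all of $\mathcal B$. In (ii), if an argument $t$ of $f_3$ (or $g_3$) lies in $[0,1]$ rather than $\{0,1\}$, the value is understood by affine interpolation, e.g. $f_3(x,a_1,t)=(1-t)f_3(x,a_1,0)+t\,f_3(x,a_1,1)$ and $f_3(x,t,a_3)=(1-t)f_3(x,0,a_3)+t\,f_3(x,1,a_3)$; for deterministic wirings this is ordinary composition. *)

(* Defs.v *)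
From mathcomp Require Import all_boot all_order all_algebra.
From mathcomp Require Import reals.
From mathcomp Require Import ring.

Set Implicit Arguments.
Unset Strict Implicit.
Unset Printing Implicit Defensive.

Import Order.TTheory GRing.Theory Num.Theory.
Local Open Scope ring_scope.

(* Bits are booleans, with [true] standing for 1.  The value P(a,b|x,y) is
   [P (a, b, x, y)]; using [R^o] makes [box R] a left [R]-module, and two boxes
   are equal exactly when they agree at every point. *)
Definition box (R : realType) := {ffun bool * bool * bool * bool -> R^o}.

Definition affine_bit (R : realType) (h : bool -> R) (t : R) : R :=
  (1 - t) * h false + t * h true.

Definition box_at (R : realType) (P : box R) (a b : bool) (alpha beta : R) : R :=
  (1 - alpha) * (1 - beta) * P (a, b, false, false)
  + (1 - alpha) * beta * P (a, b, false, true)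
  + alpha * (1 - beta) * P (a, b, true, false)
  + alpha * beta * P (a, b, true, true).

(* The last two fields say that, for a given input, at most one of a party's two
   box inputs depends on the output of the other box. *)
Record wiring (R : realType) := Wiring {
  f1 : bool -> bool -> R;
  f2 : bool -> bool -> R;
  g1 : bool -> bool -> R;
  g2 : bool -> bool -> R;
  f3 : bool -> bool -> bool -> R;
  g3 : bool -> bool -> bool -> R;
  f1_01 : forall x a, 0 <= f1 x a <= 1;
  f2_01 : forall x a, 0 <= f2 x a <= 1;
  g1_01 : forall y b, 0 <= g1 y b <= 1;
  g2_01 : forall y b, 0 <= g2 y b <= 1;
  f3_01 : forall x a1 a2, 0 <= f3 x a1 a2 <= 1;
  g3_01 : forall y b1 b2, 0 <= g3 y b1 b2 <= 1;
  f_noncyclic : forall x,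
    (f1 x false - f1 x true) * (f2 x false - f2 x true) = 0;
  g_noncyclic : forall y,
    (g1 y false - g1 y true) * (g2 y false - g2 y true) = 0
}.

(* The probability of outputting the bit [a] when 1 is output with
   probability [p]. *)
Definition bit_prob (R : realType) (p : R) (a : bool) : R :=
  if a then p else 1 - p.

Definition boxprod (R : realType) (W : wiring R) (P Q : box R) : box R :=
  [ffun z : bool * bool * bool * bool => let: (a, b, x, y) := z in
    \sum_(a1 : bool) \sum_(a2 : bool) \sum_(b1 : bool) \sum_(b2 : bool)
      box_at P a1 b1 (f1 W x a2) (g1 W y b2)
      * box_at Q a2 b2 (f2 W x a1) (g2 W y b1)
      * bit_prob (f3 W x a1 a2) a * bit_prob (g3 W y b1 b2) b].

Definition symmetric_last (R : realType) (h : bool -> bool -> bool -> R) : Prop :=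
  forall x a1 a2, h x a1 a2 = h x a2 a1.

(* h(x,a1,h(x,a2,a3)) = h(x,h(x,a1,a2),a3), where a real number occurring as an
   argument is read by affine interpolation between the values at 0 and 1. *)
Definition associative_last (R : realType) (h : bool -> bool -> bool -> R) : Prop :=
  forall x a1 a2 a3,
    affine_bit (fun t => h x a1 t) (h x a2 a3)
    = affine_bit (fun t => h x t a3) (h x a1 a2).

Lemma box_at_linear (R : realType) a b (alpha beta : R) :
  linear_for *%R (fun P : box R => box_at P a b alpha beta).
Proof.
by move=> k P Q; rewrite /box_at !ffunE /GRing.scale /=; ring.
Qed.

Lemma boxprod_linearl (R : realType) (W : wiring R) (Q : box R) :
  linear (fun P => boxprod W P Q).
Proof.
move=> k P P'; apply/ffunP => -[[[a b] x] y]; rewrite !ffunE /=.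
rewrite scaler_sumr -big_split; apply: eq_bigr => a1 _ /=.
rewrite scaler_sumr -big_split; apply: eq_bigr => a2 _ /=.
rewrite scaler_sumr -big_split; apply: eq_bigr => b1 _ /=.
rewrite scaler_sumr -big_split; apply: eq_bigr => b2 _ /=.
by rewrite box_at_linear /GRing.scale /=; ring.
Qed.

Lemma boxprod_linearr (R : realType) (W : wiring R) (P : box R) :
  linear (boxprod W P).
Proof.
move=> k Q Q'; apply/ffunP => -[[[a b] x] y]; rewrite !ffunE /=.
rewrite scaler_sumr -big_split; apply: eq_bigr => a1 _ /=.
rewrite scaler_sumr -big_split; apply: eq_bigr => a2 _ /=.
rewrite scaler_sumr -big_split; apply: eq_bigr => b1 _ /=.
rewrite scaler_sumr -big_split; apply: eq_bigr => b2 _ /=.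
by rewrite box_at_linear /GRing.scale /=; ring.
Qed.

(* Main.v *)
(** When each party feeds the same input to both boxes, the (a, b | x, y) entry
    of a product only involves the two boxes evaluated at (f x, g y), combined
    through the product kernel F(a | x, a1, a2) G(b | y, b1, b2).  On boxes
    whose outputs are deterministic and do not depend on the inputs,
    commutativity and associativity become identities between product kernels;
    summing out b or a separates them into an identity on [f3] and one on
    [g3].  For associativity, composing two kernels with binary outputs is
    affine interpolation. *)
Require Import Defs.
From mathcomp Require Import all_boot all_order all_algebra.
From mathcomp Require Import reals.
From mathcomp Require Import ring.

Set Implicit Arguments.
Unset Strict Implicit.
Unset Printing Implicit Defensive.

Import Order.TTheory GRing.Theory Num.Theory.
Local Open Scope ring_scope.

Section WiredPairs.
Variable R : realType.
Implicit Types (u v : bool -> bool -> R) (p q s : bool -> bool -> R).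

(** One entry of a product at fixed inputs: [u] and [v] play the roles of [f3 W x] and [g3 W y],
    while [p] and [q] are the boxes already evaluated. The result has the type of [p] and [q], so
    [wire] can be nested. *)
Definition wire u v p q (a b : bool) : R :=
  \sum_(a1 : bool) \sum_(a2 : bool) \sum_(b1 : bool) \sum_(b2 : bool)
    p a1 b1 * q a2 b2 * bit_prob (u a1 a2) a * bit_prob (v b1 b2) b.

Lemma eq_wire u v p p' q q' a b :
  p =2 p' -> q =2 q' -> wire u v p q a b = wire u v p' q' a b.
Proof.
move=> pE qE; apply: eq_bigr => a1 _; apply: eq_bigr => a2 _.
by apply: eq_bigr => b1 _; apply: eq_bigr => b2 _; rewrite pE qE.
Qed.

Lemma wireC u v p q a b :
  (forall a1 a2, u a1 a2 = u a2 a1) -> (forall b1 b2, v b1 b2 = v b2 b1) ->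
  wire u v p q a b = wire u v q p a b.
Proof.
move=> uC vC; rewrite /wire exchange_big.
apply: eq_bigr => a1 _; apply: eq_bigr => a2 _; rewrite exchange_big.
apply: eq_bigr => b1 _; apply: eq_bigr => b2 _.
by rewrite (uC a2) (vC b2) (mulrC (p _ _)).
Qed.

(** The inner output bit [t] has weight [bit_prob r t] with [r = u a2 a3]. These weights sum to 1
    and [bit_prob] is affine in its first argument, so summing over [t] interpolates [u a1] at [r];
    likewise for [v]. *)
Lemma wire_wirer u v p q s a b :
  wire u v p (wire u v q s) a b =
  \sum_(a1 : bool) \sum_(a2 : bool) \sum_(a3 : bool)
  \sum_(b1 : bool) \sum_(b2 : bool) \sum_(b3 : bool)
    p a1 b1 * q a2 b2 * s a3 b3
    * bit_prob (affine_bit (fun t => u a1 t) (u a2 a3)) a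
    * bit_prob (affine_bit (fun t => v b1 t) (v b2 b3)) b.
Proof.
by rewrite /wire !big_bool /bit_prob /affine_bit /=; case: a; case: b; ring.
Qed.

Lemma wire_wirel u v p q s a b :
  wire u v (wire u v p q) s a b =
  \sum_(a1 : bool) \sum_(a2 : bool) \sum_(a3 : bool)
  \sum_(b1 : bool) \sum_(b2 : bool) \sum_(b3 : bool)
    p a1 b1 * q a2 b2 * s a3 b3
    * bit_prob (affine_bit (fun t => u t a3) (u a1 a2)) a
    * bit_prob (affine_bit (fun t => v t b3) (v b1 b2)) b.
Proof.
by rewrite /wire !big_bool /bit_prob /affine_bit /=; case: a; case: b; ring.
Qed.

Definition dirac2 (a b i j : bool) : R := ((i == a) && (j == b))%:R.

Lemma sum_bool1 (j : bool) (F : bool -> R) :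
  (forall i, i != j -> F i = 0) -> \sum_(i : bool) F i = F j.
Proof. by move=> F0; rewrite (bigD1 j) //= big1 ?addr0. Qed.

(** Point masses isolate a single entry of the product kernel, which is how [f3] and [g3] are
    recovered from the product of boxes. *)
Lemma wire_dirac2 u v a1 b1 a2 b2 a b :
  wire u v (dirac2 a1 b1) (dirac2 a2 b2) a b =
  bit_prob (u a1 a2) a * bit_prob (v b1 b2) b.
Proof.
rewrite /wire (sum_bool1 (j := a1)); last first.
  move=> i /negbTE ne; do 3 (rewrite big1 // => ? _).
  by rewrite /dirac2 ne !(mul0r, mulr0).
rewrite (sum_bool1 (j := a2)); last first.
  move=> i /negbTE ne; do 2 (rewrite big1 // => ? _).
  by rewrite /dirac2 ne !(mul0r, mulr0).
rewrite (sum_bool1 (j := b1)); last first.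
  move=> i /negbTE ne; rewrite big1 // => ? _.
  by rewrite /dirac2 ne andbF !(mul0r, mulr0).
rewrite (sum_bool1 (j := b2)); last first.
  by move=> i /negbTE ne; rewrite /dirac2 ne andbF !(mul0r, mulr0).
by rewrite /dirac2 !eqxx !mul1r.
Qed.

(** [F] and [G] are left arbitrary so that the same collapse serves both bracketings of a triple
    product. *)
Lemma sum_dirac2_3 (F : bool -> bool -> bool -> R) (G : bool -> bool -> bool -> R)
    a1 b1 a2 b2 a3 b3 :
  \sum_(i1 : bool) \sum_(i2 : bool) \sum_(i3 : bool)
  \sum_(j1 : bool) \sum_(j2 : bool) \sum_(j3 : bool)
    dirac2 a1 b1 i1 j1 * dirac2 a2 b2 i2 j2 * dirac2 a3 b3 i3 j3
    * F i1 i2 i3 * G j1 j2 j3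
  = F a1 a2 a3 * G b1 b2 b3.
Proof.
rewrite (sum_bool1 (j := a1)); last first.
  move=> i /negbTE ne; do 5 (rewrite big1 // => ? _).
  by rewrite /dirac2 ne !(mul0r, mulr0).
rewrite (sum_bool1 (j := a2)); last first.
  move=> i /negbTE ne; do 4 (rewrite big1 // => ? _).
  by rewrite /dirac2 ne !(mul0r, mulr0).
rewrite (sum_bool1 (j := a3)); last first.
  move=> i /negbTE ne; do 3 (rewrite big1 // => ? _).
  by rewrite /dirac2 ne !(mul0r, mulr0).
rewrite (sum_bool1 (j := b1)); last first.
  move=> i /negbTE ne; do 2 (rewrite big1 // => ? _).
  by rewrite /dirac2 ne andbF !(mul0r, mulr0).
rewrite (sum_bool1 (j := b2)); last first.
  move=> i /negbTE ne; rewrite big1 // => ? _.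
  by rewrite /dirac2 ne andbF !(mul0r, mulr0).
rewrite (sum_bool1 (j := b3)); last first.
  by move=> i /negbTE ne; rewrite /dirac2 ne andbF !(mul0r, mulr0).
by rewrite /dirac2 !eqxx !mul1r.
Qed.

Lemma wire_wirer_dirac2 u v a1 b1 a2 b2 a3 b3 a b :
  wire u v (dirac2 a1 b1) (wire u v (dirac2 a2 b2) (dirac2 a3 b3)) a b =
  bit_prob (affine_bit (fun t => u a1 t) (u a2 a3)) a
  * bit_prob (affine_bit (fun t => v b1 t) (v b2 b3)) b.
Proof.
by rewrite wire_wirer (sum_dirac2_3
  (fun i1 i2 i3 => bit_prob (affine_bit (fun t => u i1 t) (u i2 i3)) a)
  (fun j1 j2 j3 => bit_prob (affine_bit (fun t => v j1 t) (v j2 j3)) b)).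
Qed.

Lemma wire_wirel_dirac2 u v a1 b1 a2 b2 a3 b3 a b :
  wire u v (wire u v (dirac2 a1 b1) (dirac2 a2 b2)) (dirac2 a3 b3) a b =
  bit_prob (affine_bit (fun t => u t a3) (u a1 a2)) a
  * bit_prob (affine_bit (fun t => v t b3) (v b1 b2)) b.
Proof.
by rewrite wire_wirel (sum_dirac2_3
  (fun i1 i2 i3 => bit_prob (affine_bit (fun t => u t i3) (u i1 i2)) a)
  (fun j1 j2 j3 => bit_prob (affine_bit (fun t => v t j3) (v j1 j2)) b)).
Qed.

(* Both bit distributions sum to 1, so they are the marginals of their product. *)
Lemma bit_prob_mul_inj (r s r' s' : R) :
  (forall a b,
     bit_prob r a * bit_prob s b = bit_prob r' a * bit_prob s' b) ->
  r = r' /\ s = s'.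
Proof.
move=> e; have [ett etf eft] := And3 (e true true) (e true false) (e false true).
rewrite /bit_prob in ett etf eft; split.
  have -> : r = r * s + r * (1 - s) by ring.
  by rewrite ett etf; ring.
have -> : s = r * s + (1 - r) * s by ring.
by rewrite ett eft; ring.
Qed.

Lemma box_at_bit (P : box R) a b (x y : bool) :
  box_at P a b x%:R y%:R = P (a, b, x, y).
Proof. by case: x; case: y; rewrite /box_at /=; ring. Qed.

Definition dirac_box (a b : bool) : box R :=
  [ffun z => dirac2 a b z.1.1.1 z.1.1.2].

(** The four interpolation weights sum to 1 and the box ignores its inputs. Hence commutativity can
    be tested on these boxes for arbitrary [f] and [g]. *)
Lemma box_at_dirac a b i j alpha beta :
  box_at (dirac_box a b) i j alpha beta = dirac2 a b i j.
Proof. by rewrite /box_at !ffunE /=; ring. Qed.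

Lemma boxprod_wire (W : wiring R) (f g : bool -> R)
    (f1E : forall x a : bool, f1 W x a = f x)
    (f2E : forall x a : bool, f2 W x a = f x)
    (g1E : forall y b : bool, g1 W y b = g y)
    (g2E : forall y b : bool, g2 W y b = g y) P Q a b x y :
  boxprod W P Q (a, b, x, y) =
  wire (f3 W x) (g3 W y) (fun i j => box_at P i j (f x) (g y))
    (fun i j => box_at Q i j (f x) (g y)) a b.
Proof.
rewrite ffunE; apply: eq_bigr => a1 _; apply: eq_bigr => a2 _.
by apply: eq_bigr => b1 _; apply: eq_bigr => b2 _; rewrite f1E f2E g1E g2E.
Qed.

End WiredPairs.

Arguments dirac2 {R}.
Arguments dirac_box {R}.

Theorem proposition7 (R : realType) (W : wiring R) (f g : bool -> R)
    (f_01 : forall x : bool, 0 <= f x <= 1)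
    (g_01 : forall y : bool, 0 <= g y <= 1)
    (f1E : forall x a : bool, f1 W x a = f x)
    (f2E : forall x a : bool, f2 W x a = f x)
    (g1E : forall y b : bool, g1 W y b = g y)
    (g2E : forall y b : bool, g2 W y b = g y) :
  (commutative (boxprod W) <->
     symmetric_last (f3 W) /\ symmetric_last (g3 W)) /\
  ((forall x : bool, f x = x%:R) -> (forall y : bool, g y = y%:R) ->
   (associative (boxprod W) <->
      associative_last (f3 W) /\ associative_last (g3 W))).
Proof.
have prodE := boxprod_wire f1E f2E g1E g2E; split; first split.
- move=> prodC.
  have fgC x y a1 a2 b1 b2 :
      f3 W x a1 a2 = f3 W x a2 a1 /\ g3 W y b1 b2 = g3 W y b2 b1.
    apply: bit_prob_mul_inj => a b.
    have prod_dirac c1 d1 c2 d2 :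
        boxprod W (dirac_box c1 d1) (dirac_box c2 d2) (a, b, x, y) =
        bit_prob (f3 W x c1 c2) a * bit_prob (g3 W y d1 d2) b.
      rewrite prodE -wire_dirac2.
      by apply: eq_wire => i j; rewrite box_at_dirac.
    by rewrite -!prod_dirac prodC.
  (* Each half of [fgC] needs some data for the other party; any will do, so the given bits are
     reused. *)
  by split=> [x a1 a2|y b1 b2];
    [have [] := fgC x x a1 a2 a1 a2 | have [] := fgC y y b1 b2 b1 b2].
- move=> [fC gC] P Q; apply/ffunP => -[[[a b] x] y].
  by rewrite !prodE; apply: wireC; [apply: fC | apply: gC].
move=> fE gE.
(* With bit inputs an inner product is read only at the same (x, y), so nested products become
   nested wires with one kernel. For general [f] and [g] the inner product would mix the kernels of
   different inputs. *)
have prodbE P Q a b x y : boxprod W P Q (a, b, x, y) =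
    wire (f3 W x) (g3 W y) (fun i j => P (i, j, x, y))
      (fun i j => Q (i, j, x, y)) a b.
  by rewrite prodE fE gE; apply: eq_wire => i j; rewrite box_at_bit.
have prodrE P Q S a b x y : boxprod W P (boxprod W Q S) (a, b, x, y) =
    wire (f3 W x) (g3 W y) (fun i j => P (i, j, x, y))
      (wire (f3 W x) (g3 W y) (fun i j => Q (i, j, x, y))
        (fun i j => S (i, j, x, y))) a b.
  by rewrite prodbE; apply: eq_wire => // i j; rewrite prodbE.
have prodlE P Q S a b x y : boxprod W (boxprod W P Q) S (a, b, x, y) =
    wire (f3 W x) (g3 W y)
      (wire (f3 W x) (g3 W y) (fun i j => P (i, j, x, y))
        (fun i j => Q (i, j, x, y)))
      (fun i j => S (i, j, x, y)) a b.
  by rewrite prodbE; apply: eq_wire => // i j; rewrite prodbE.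
split.
- move=> prodA.
  have fgA x y a1 a2 a3 b1 b2 b3 :
      affine_bit (fun t => f3 W x a1 t) (f3 W x a2 a3)
        = affine_bit (fun t => f3 W x t a3) (f3 W x a1 a2)
      /\ affine_bit (fun t => g3 W y b1 t) (g3 W y b2 b3)
        = affine_bit (fun t => g3 W y t b3) (g3 W y b1 b2).
    apply: bit_prob_mul_inj => a b.
    have diracE i j k l : dirac_box i j (k, l, x, y) = dirac2 i j k l.
      by rewrite ffunE.
    rewrite -wire_wirer_dirac2 -wire_wirel_dirac2.
    (* The nested wire is recognized as an entry of an actual triple product, to which [prodA]
       applies. *)
    transitivity (boxprod W (dirac_box a1 b1)
        (boxprod W (dirac_box a2 b2) (dirac_box a3 b3)) (a, b, x, y)).
      rewrite prodrE; apply: eq_wire => i j; first by rewrite diracE.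
      by apply: eq_wire => k l; rewrite diracE.
    rewrite prodA prodlE; apply: eq_wire => i j; last by rewrite diracE.
    by apply: eq_wire => k l; rewrite diracE.
  by split=> [x a1 a2 a3|y b1 b2 b3];
    [have [] := fgA x x a1 a2 a3 a1 a2 a3 | have [] := fgA y y b1 b2 b3 b1 b2 b3].
move=> [fA gA] P Q S; apply/ffunP => -[[[a b] x] y].
(* Both sides become sums over the same six bits, whose terms differ only in the interpolated values
   equated by [fA] and [gA]. *)
rewrite prodrE prodlE wire_wirer wire_wirel.
do 3 (apply: eq_bigr => ? _); do 3 (apply: eq_bigr => ? _).
by rewrite fA gA.
Qed.
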